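(* Let $n=1$, $p>1$ and $R>0$. Assume that $f\in C^2(\mathbf{R})$ and $g\in C^1(\mathbf{R})$ have compact support with $\mathrm{supp}(f,g)\subset\{x\in\mathbf{R}:|x|\le R\}$. For $\varepsilon>0$, suppose that the initial value problem $$u_{tt}-u_{xx}=|u|^p\ \text{ in }\mathbf{R}\times[0,\infty),\qquad u(x,0)=\varepsilon f(x),\quad u_t(x,0)=\varepsilon g(x)$$ has a solution $u\in C^2(\mathbf{R}\times[0,T(\varepsilon)))$, where $T(\varepsilon)$ is the lifespan. Then there exist a positive constant $\varepsilon_3=\varepsilon_3(f,g,p,R)$ and a positive constant $C$ independent of $\varepsilon$ such that, for all $0<\varepsilon\le\varepsilon_3$, $$T(\varepsilon)\le C\varepsilon^{-(p-1)/2}\quad\text{if }\int_{\mathbf{R}}g(x)\,dx>0,$$ $$T(\varepsilon)\le C\varepsilon^{-p(p-1)/(p+1)}\quad\text{if } f\ge0,\ f\not\equiv0,\ g\equiv0.$$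
   Context: Lifespan: for fixed $(f,g)$, $T(\varepsilon)\in(0,\infty]$ is the supremum of all $t>0$ such that a solution $u(x,t)$ of the initial value problem exists up to time $t$; here solutions are classical ($C^2$). *)

(* Defs.v *)
From Stdlib Require Import Reals.
From Coquelicot Require Import Coquelicot.
Open Scope R_scope.

(** [|x|^p] for a real exponent [p > 0].  The case [x = 0] is separate because
    Stdlib's [Rpower 0 p] equals [1]. *)
Definition abs_power (p x : R) : R :=
  if Req_EM_T x 0 then 0 else Rpower (Rabs x) p.

Definition class_C (n : nat) (h : R -> R) : Prop :=
  (forall (k : nat) (x : R), (k <= n)%nat -> ex_derive_n h k x) /\
  (forall x : R, continuous (Derive_n h n) x).

(** supp(f, g): the closure of the set where f or g does not vanish. *)
Definition support2 (f g : R -> R) : R -> Prop :=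
  adherence (fun x => f x <> 0 \/ g x <> 0).

(** The set R x [0, T), in the variables (x, t), with T possibly infinite. *)
Definition slab (T : Rbar) (z : R * R) : Prop :=
  0 <= snd z /\ Rbar_lt (snd z) T.

Definition continuous_slab (T : Rbar) (v : R -> R -> R) : Prop :=
  continuous_on (slab T) (fun z : R * R => v (fst z) (snd z)).

Definition is_Dx (T : Rbar) (v vx : R -> R -> R) : Prop :=
  forall x t : R, slab T (x, t) -> is_derive (fun y => v y t) x (vx x t).

(** The time increments stay in [0, T): the derivative is one-sided at t = 0
    and two-sided for t > 0. *)
Definition is_Dt (T : Rbar) (v vt : R -> R -> R) : Prop :=
  forall x t : R, slab T (x, t) ->
    filterlim (fun s => (v x s - v x t) / (s - t))
      (within (fun s => slab T (x, s)) (locally' t)) (locally (vt x t)).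

Definition C1_slab (T : Rbar) (v vx vt : R -> R -> R) : Prop :=
  is_Dx T v vx /\ is_Dt T v vt /\
  continuous_slab T v /\ continuous_slab T vx /\ continuous_slab T vt.

(** [u] is of class C^2 on R x [0, T) and solves
    u_tt - u_xx = |u|^p, u(x, 0) = u0 x, u_t(x, 0) = u1 x there.
    The values of [u] outside R x [0, T) are irrelevant. *)
Definition classical_solution (p : R) (u0 u1 : R -> R) (T : Rbar)
    (u : R -> R -> R) : Prop :=
  Rbar_lt 0 T /\
  exists ux ut uxx uxt utx utt : R -> R -> R,
    C1_slab T u ux ut /\ C1_slab T ux uxx uxt /\ C1_slab T ut utx utt /\
    (forall x t : R, slab T (x, t) ->
       utt x t - uxx x t = abs_power p (u x t)) /\
    (forall x : R, u x 0 = u0 x) /\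
    (forall x : R, ut x 0 = u1 x).

Definition lifespan (p : R) (f g : R -> R) (eps : R) : Rbar :=
  Lub_Rbar (fun t : R => exists u : R -> R -> R,
    classical_solution p (fun x => eps * f x) (fun x => eps * g x) t u).

(* Main.v *)
(** Test the equation with the polynomial cutoffs [chi(x) = (1 - x^2/tau^2)^k] and
    [eta(t) = (1 - t^2/tau^2)^k] on [-tau, tau] x [0, tau], [k] large.  With
    [J(t) = int (u_t eta - u eta') chi dx], integration by parts in [x] gives
    [J' = int (|u|^p chi eta + u (chi'' eta - chi eta'')) dx], and Young's inequality
    absorbs half of the nonlinear term:
    [J' >= int |u|^p chi eta dx / 2 - C tau^(-1-2q)], [q = 1/(p-1)].
    Since [J(tau) = 0] and [J(0) = eps int g chi dx], the mean value theorem in [t]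
    yields [eps int g <= C tau^(-2q)], the first bound.  If [g = 0] and [f >= 0], then
    [J(0) = 0], and d'Alembert's formula with a nonnegative source gives
    [u(x,t) >= eps f(x-t)/2]; hence [int |u|^p chi eta dx >= c eps^p] for [t <= tau/2],
    so [eps^p tau <= C tau^(-2q)], the second bound. *)

Require Import Defs.
From Stdlib Require Import Reals Lra Lia Classical.
From Coquelicot Require Import Coquelicot.
Open Scope R_scope.

(** * Parameter integrals and calculus on the slab *)

(** Continuity on the compact segment [[a, b] x {t}] is uniform, so the integrands at times [s] and
    [t] are uniformly close for [s] near [t]. *)
Lemma continuity_pt_RInt_param (W : R -> R -> R) (a b t : R) :
  a <= b ->
  (forall x, a <= x <= b -> continuity_2d_pt W x t) ->
  locally t (fun s => ex_RInt (fun x => W x s) a b) ->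
  continuity_pt (fun s => RInt (fun x => W x s) a b) t.
Proof.
  intros Hab HW Hex.
  apply continuity_pt_filterlim, filterlim_locally; intros eps.
  (* The extra [1] keeps the divisor positive when [a = b] and makes the final estimate strict. *)
  assert (Hpos : 0 < eps / (b - a + 1)).
  { apply Rdiv_lt_0_compat; [apply cond_pos | lra]. }
  destruct (uniform_continuity_2d_1d W a b t HW (mkposreal _ Hpos)) as [d Hd].
  assert (Hext := locally_singleton _ _ Hex).
  apply filter_imp with (2 := filter_and _ _ Hex (locally_ball t d)).
  intros s [Hs1 Hs2].
  change (Rabs (s - t) < d) in Hs2.
  change (Rabs (RInt (fun x => W x s) a b - RInt (fun x => W x t) a b) < eps).
  rewrite <- (RInt_minus (V := R_CompleteNormedModule)) by assumption.
  apply Rle_lt_trans with ((b - a) * (eps / (b - a + 1))).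
  - apply abs_RInt_le_const; [exact Hab | apply @ex_RInt_minus; assumption |].
    intros x Hx. left. apply Rabs_def2 in Hs2.
    assert (Hd0 := cond_pos d).
    apply (Hd x t x s); try lra.
    rewrite Rminus_diag, Rabs_R0; exact Hd0.
  - assert (He := cond_pos eps).
    replace ((b - a) * (eps / (b - a + 1))) with (eps * ((b - a) / (b - a + 1)))
      by (field; lra).
    rewrite <- (Rmult_1_r eps) at 2.
    apply Rmult_lt_compat_l; [exact He |].
    apply Rmult_lt_reg_r with (b - a + 1); [lra |].
    unfold Rdiv. rewrite Rmult_assoc, Rinv_l; lra.
Qed.

Lemma continuity_2d_pt_slice (W : R -> R -> R) (x t : R) :
  continuity_2d_pt W x t -> continuous (fun y => W y t) x.
Proof.
  intros H. apply filterlim_locally; intros eps.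
  exact (locally_2d_1d_const_y _ _ _ (H eps)).
Qed.

Lemma ex_RInt_slice (W : R -> R -> R) (a b t : R) :
  (forall x, continuity_2d_pt W x t) -> ex_RInt (fun x => W x t) a b.
Proof.
  intros H. apply @ex_RInt_continuous; intros x _.
  apply continuity_2d_pt_slice, H.
Qed.

Lemma continuity_2d_pt_swap (W : R -> R -> R) (x t : R) :
  continuity_2d_pt W x t -> continuity_2d_pt (fun s y => W y s) t x.
Proof.
  intros H eps. destruct (H eps) as [d Hd].
  exists d; intros s y Hs Hy. exact (Hd y s Hy Hs).
Qed.

(** Differentiation under the integral sign followed by the mean value theorem in [t]. A bound at
    the single time [xi] then replaces an integration in time. The derivative is required only for
    [t > c], so [c] may be the initial time. *)
Lemma RInt_param_mvt (T : Rbar) (W Wt : R -> R -> R) (a b c d : R) :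
  a <= b -> c < d -> Rbar_lt d T ->
  (forall x t : R, Rbar_lt t T -> continuity_2d_pt W x t) ->
  (forall x t : R, c < t -> Rbar_lt t T -> is_derive (W x) t (Wt x t)) ->
  (forall x t : R, c < t -> Rbar_lt t T -> continuity_2d_pt Wt x t) ->
  exists xi, c <= xi <= d /\
    RInt (fun x => W x d) a b - RInt (fun x => W x c) a b =
    (d - c) * RInt (fun x => Wt x xi) a b.
Proof.
  intros Hab Hcd HdT HW Hder HWt.
  assert (Hlt : forall t, t <= d -> Rbar_lt t T).
  { intros t Ht. apply Rbar_le_lt_trans with d; [exact Ht | exact HdT]. }
  assert (Hloc : forall t : R, Rbar_lt t T -> locally t (fun s : R => Rbar_lt s T)).
  { intros t Ht. exact (open_Rbar_lt T t Ht). }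
  assert (Hmin : Rmin c d = c) by (apply Rmin_left; lra).
  assert (Hmax : Rmax c d = d) by (apply Rmax_right; lra).
  destruct (MVT_gen (fun t => RInt (fun x => W x t) a b) c d
              (fun t => RInt (fun x => Wt x t) a b)) as [xi [Hxi E]].
  - rewrite Hmin, Hmax. intros t Ht.
    assert (HtT : Rbar_lt t T) by (apply Hlt; lra).
    assert (Hc : locally t (fun s => c < s)) by (apply open_gt; lra).
    rewrite <- (RInt_ext (fun x => Derive (fun s => W x s) t)).
    2:{ intros x _. apply is_derive_unique, Hder; [lra | exact HtT]. }
    apply (is_derive_RInt_param (fun s x => W x s)).
    + apply filter_imp with (2 := filter_and _ _ Hc (Hloc t HtT)).
      intros s [Hs1 Hs2] x _. eexists. apply Hder; assumption.
    + intros x _.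
      apply continuity_2d_pt_ext_loc with (f := fun s y => Wt y s).
      * destruct (filter_and _ _ Hc (Hloc t HtT)) as [e He].
        exists e; intros s y Hs _. symmetry.
        apply is_derive_unique, Hder; apply (He s Hs).
      * apply continuity_2d_pt_swap, HWt; [lra | exact HtT].
    + apply filter_imp with (2 := Hloc t HtT). intros s Hs.
      apply ex_RInt_slice; intros x; apply HW, Hs.
  - rewrite Hmin, Hmax. intros t Ht.
    apply continuity_pt_RInt_param; [exact Hab | |].
    + intros x _. apply HW, Hlt; lra.
    + apply filter_imp with (2 := Hloc t (Hlt t (proj2 Ht))). intros s Hs.
      apply ex_RInt_slice; intros x; apply HW, Hs.
  - rewrite Hmin, Hmax in Hxi. exists xi; split; [exact Hxi |].
    rewrite E. ring.
Qed.

(* Extending [v] to [s < 0] by its value at [s = 0] trades the one-sided continuity at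
   the initial time for continuity on an open set. *)
Lemma continuous_slab_clamp (T : Rbar) (v : R -> R -> R) (x t : R) :
  Rbar_lt 0 T -> continuous_slab T v -> Rbar_lt t T ->
  continuity_2d_pt (fun y s => v y (Rmax 0 s)) x t.
Proof.
  intros HT Hv Ht.
  assert (Hs : forall s : R, Rbar_lt s T -> slab T (x, Rmax 0 s)).
  { intros s Hs. split; simpl; [apply Rmax_l |].
    unfold Rmax; destruct (Rle_dec 0 s); assumption. }
  intros eps.
  destruct (proj1 (filterlim_locally _ _) (Hv _ (Hs t Ht)) eps) as [d Hd].
  destruct (open_Rbar_lt T t Ht) as [d' Hd'].
  assert (Hm : 0 < Rmin d d') by (apply Rmin_pos; apply cond_pos).
  exists (mkposreal _ Hm); simpl; intros y s Hy Hst.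
  apply (Hd (y, Rmax 0 s)).
  - split; simpl.
    + apply Rlt_le_trans with (1 := Hy), Rmin_l.
    + change (Rabs (Rmax 0 s - Rmax 0 t) < d).
      apply Rle_lt_trans with (Rabs (s - t)).
      * unfold Rmax; destruct (Rle_dec 0 s), (Rle_dec 0 t);
          unfold Rabs; repeat destruct Rcase_abs; lra.
      * apply Rlt_le_trans with (1 := Hst), Rmin_l.
  - apply Hs, Hd'.
    apply Rlt_le_trans with (1 := Hst), Rmin_r.
Qed.

Lemma continuous_slab_interior (T : Rbar) (v : R -> R -> R) (x t : R) :
  continuous_slab T v -> 0 < t -> Rbar_lt t T -> continuity_2d_pt v x t.
Proof.
  intros Hv H0 Ht.
  apply continuity_2d_pt_ext_loc with (f := fun y s => v y (Rmax 0 s)).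
  - exists (mkposreal t H0); simpl; intros y s _ Hs.
    apply Rabs_def2 in Hs. rewrite Rmax_right by lra. reflexivity.
  - apply continuous_slab_clamp with T; try assumption.
    apply Rbar_lt_trans with t; [exact H0 | exact Ht].
Qed.

Lemma continuous_slab_slice (T : Rbar) (v : R -> R -> R) (x t : R) :
  continuous_slab T v -> slab T (x, t) -> continuous (fun y => v y t) x.
Proof.
  intros Hv [H0 Ht]; simpl in H0, Ht.
  apply continuous_ext with (f := fun y => v y (Rmax 0 t)).
  - intros y. rewrite Rmax_right by exact H0. reflexivity.
  - apply (continuity_2d_pt_slice (fun y s => v y (Rmax 0 s))).
    apply continuous_slab_clamp with T; try assumption.
    apply Rbar_le_lt_trans with t; [exact H0 | exact Ht].
Qed.

(** At an interior time all sufficiently small increments stay in [[0, T)], so the restricted limit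
    is an ordinary derivative. *)
Lemma is_Dt_interior (T : Rbar) (v vt : R -> R -> R) (x t : R) :
  is_Dt T v vt -> 0 < t -> Rbar_lt t T -> is_derive (v x) t (vt x t).
Proof.
  intros Hv H0 Ht.
  apply is_derive_Reals; intros eps Heps.
  assert (Hs : slab T (x, t)) by (split; [left; exact H0 | exact Ht]).
  destruct (proj1 (filterlim_locally _ _) (Hv x t Hs) (mkposreal _ Heps)) as [d Hd].
  destruct (open_Rbar_lt T t Ht) as [d' Hd'].
  assert (Hm : 0 < Rmin (Rmin d d') t).
  { repeat apply Rmin_pos; try apply cond_pos; exact H0. }
  exists (mkposreal _ Hm); simpl; intros h Hh Hhd.
  assert (H1 : Rabs h < d).
  { apply Rlt_le_trans with (1 := Hhd), Rle_trans with (Rmin d d'); apply Rmin_l. }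
  assert (H2 : Rabs h < d').
  { apply Rlt_le_trans with (1 := Hhd), Rle_trans with (Rmin d d');
      [apply Rmin_l | apply Rmin_r]. }
  assert (H3 : Rabs h < t) by (apply Rlt_le_trans with (1 := Hhd), Rmin_r).
  assert (E : t + h - t = h) by ring.
  assert (Hb : forall e : posreal, Rabs h < e -> ball t e (t + h)).
  { intros e He. change (Rabs (t + h - t) < e). rewrite E. exact He. }
  specialize (Hd (t + h) (Hb d H1)).
  rewrite E in Hd. apply Hd.
  - apply Rabs_def2 in H3. lra.
  - split; simpl; [apply Rabs_def2 in H3; lra | exact (Hd' _ (Hb d' H2))].
Qed.

(** * A lower bound from d'Alembert's formula *)

Lemma continuous_Rmax_0 (t : R) : continuous (Rmax 0) t.
Proof.
  apply filterlim_locally; intros eps.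
  exists eps; intros s Hs.
  change (Rabs (Rmax 0 s - Rmax 0 t) < eps).
  change (Rabs (s - t) < eps) in Hs.
  apply Rle_lt_trans with (2 := Hs).
  unfold Rmax; destruct (Rle_dec 0 s), (Rle_dec 0 t);
    unfold Rabs; repeat destruct Rcase_abs; lra.
Qed.

(** Chain rule: [v] is totally differentiable because [vx] exists nearby and is continuous at the
    point, while [vt] exists there. The values [sigma = 1] and [sigma = -1] give the two families of
    characteristics. *)
Lemma is_derive_along_line (T : Rbar) (v vx vt : R -> R -> R) (a sigma t : R) :
  C1_slab T v vx vt -> 0 < t -> Rbar_lt t T ->
  is_derive (fun s => v (a + sigma * s) s) t
    (sigma * vx (a + sigma * t) t + vt (a + sigma * t) t).
Proof.
  intros (Hx & Ht & _ & Cx & _) H0 HT.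
  assert (HD : differentiable_pt_lim v (a + sigma * t) t
                 (vx (a + sigma * t) t) (vt (a + sigma * t) t)).
  { apply filterdiff_differentiable_pt_lim.
    apply is_derive_filterdiff with (dfx := vx) (dfy := vt (a + sigma * t) t).
    - apply (proj1 (locally_2d_locally
               (fun y s => is_derive (fun z => v z s) y (vx y s)) _ _)).
      destruct (filter_and _ _ (open_gt 0 t H0) (open_Rbar_lt T t HT)) as [e He].
      exists e; intros y s _ Hs. apply Hx.
      destruct (He s Hs) as [H1 H2]. split; [left; exact H1 | exact H2].
    - apply is_Dt_interior with T; assumption.
    - apply continuity_2d_pt_filterlim, continuous_slab_interior with T; assumption. }
  apply is_derive_Reals.
  replace (sigma * _ + _)
    with (vx (a + sigma * t) t * sigma + vt (a + sigma * t) t * 1) by ring.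
  apply (derivable_pt_lim_comp_2d v (fun s => a + sigma * s) (fun s => s)).
  - exact HD.
  - apply is_derive_Reals. auto_derive; [exact I | ring].
  - apply is_derive_Reals. auto_derive; [exact I | ring].
Qed.

(** The clamp freezes the moving point at its initial position for [s < 0]; this is the form of
    continuity that [le_of_nonneg_derive] asks for. *)
Lemma continuity_pt_along_line (T : Rbar) (v : R -> R -> R) (a sigma t : R) :
  Rbar_lt 0 T -> continuous_slab T v -> Rbar_lt t T ->
  continuity_pt (fun s => v (a + sigma * Rmax 0 s) (Rmax 0 s)) t.
Proof.
  intros H0 Hv HT.
  apply continuity_pt_filterlim.
  apply (continuous_comp_2 (fun s => a + sigma * Rmax 0 s) (fun s => s)
           (fun y s => v y (Rmax 0 s)) t).
  - apply continuity_pt_filterlim. apply continuity_pt_plus.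
    + apply continuity_pt_const; intros ? ?; reflexivity.
    + apply continuity_pt_mult; [apply continuity_pt_const; intros ? ?; reflexivity |].
      apply continuity_pt_filterlim, continuous_Rmax_0.
  - apply continuous_id.
  - apply (continuity_2d_pt_filterlim (fun y s => v y (Rmax 0 s))).
    apply continuous_slab_clamp with T; assumption.
Qed.

Lemma le_of_nonneg_derive (F : R -> R) (t : R) :
  0 <= t ->
  (forall s, 0 < s < t -> exists d, is_derive F s d /\ 0 <= d) ->
  (forall s, 0 <= s <= t -> continuity_pt (fun r => F (Rmax 0 r)) s) ->
  F 0 <= F t.
Proof.
  intros Ht HD HC.
  assert (Hmin : Rmin 0 t = 0) by (apply Rmin_left, Ht).
  assert (Hmax : Rmax 0 t = t) by (apply Rmax_right, Ht).
  (* The intermediate point may be an end point, where nothing is known about [Derive F]; the outer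
     [Rmax 0] makes the slope nonnegative there too. *)
  destruct (MVT_gen (fun r => F (Rmax 0 r)) 0 t (fun s => Rmax 0 (Derive F s)))
    as [c [_ E]].
  - rewrite Hmin, Hmax; intros s Hs.
    destruct (HD s Hs) as [d [H1 H2]].
    rewrite (is_derive_unique _ _ _ H1), Rmax_right by exact H2.
    apply is_derive_ext_loc with (2 := H1).
    apply filter_imp with (2 := open_gt 0 s (proj1 Hs)).
    intros r Hr. rewrite Rmax_right by lra. reflexivity.
  - rewrite Hmin, Hmax; exact HC.
  - rewrite Hmax in E. cbv beta in E.
    assert (H := Rmult_le_pos (Rmax 0 (Derive F c)) (t - 0) (Rmax_l 0 (Derive F c)) ltac:(lra)).
    rewrite (Rmax_left 0 0) in E by lra. lra.
Qed.

(** Schwarz's theorem at interior times. It cancels the cross terms when the wave operator is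
    factored into two first-order operators. *)
Lemma mixed_derivatives_eq (T : Rbar) (u ux ut uxx uxt utx utt : R -> R -> R) (x t : R) :
  C1_slab T u ux ut -> C1_slab T ux uxx uxt -> C1_slab T ut utx utt ->
  0 < t -> Rbar_lt t T -> utx x t = uxt x t.
Proof.
  intros (Hx & Ht & _) (_ & Hxt & _ & _ & Cxt) (Htx & _ & _ & Ctx & _) H0 HT.
  assert (Hloc : locally t (fun s : R => 0 < s /\ Rbar_lt s T)).
  { apply filter_and; [apply (open_gt 0 t H0) | apply (open_Rbar_lt T t HT)]. }
  assert (Dx : forall y s : R, 0 < s /\ Rbar_lt s T -> is_derive (fun z => u z s) y (ux y s)).
  { intros y s [H1 H2]; apply Hx; split; [left |]; assumption. }
  assert (Dt : forall y s : R, 0 < s /\ Rbar_lt s T -> is_derive (u y) s (ut y s)).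
  { intros y s [H1 H2]; apply is_Dt_interior with T; assumption. }
  assert (Dtx : forall y s : R, 0 < s /\ Rbar_lt s T ->
            is_derive (fun z => Derive (fun r => u z r) s) y (utx y s)).
  { intros y s Hs.
    apply is_derive_ext with (f := fun z => ut z s).
    - intros z. symmetry. apply is_derive_unique, Dt, Hs.
    - apply Htx; split; [left |]; apply Hs. }
  assert (Dxt : forall y s : R, 0 < s /\ Rbar_lt s T ->
            is_derive (fun r => Derive (fun z => u z r) y) s (uxt y s)).
  { intros y s Hs.
    apply is_derive_ext_loc with (f := ux y).
    - apply filter_imp with (2 := filter_and _ _ (open_gt 0 s (proj1 Hs))
                                    (open_Rbar_lt T s (proj2 Hs))).
      intros r Hr. symmetry. apply is_derive_unique, Dx, Hr.
    - apply is_Dt_interior with T; try apply Hs; assumption. }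
  destruct Hloc as [e He].
  assert (Het : forall s, Rabs (s - t) < e -> 0 < s /\ Rbar_lt s T) by exact He.
  rewrite <- (is_derive_unique _ _ _ (Dtx x t (conj H0 HT))).
  rewrite <- (is_derive_unique _ _ _ (Dxt x t (conj H0 HT))).
  apply Schwarz.
  - exists e; intros y s _ Hs; specialize (Het s Hs); repeat split; eexists.
    + apply Dx, Het.
    + apply Dt, Het.
    + apply Dtx, Het.
    + apply Dxt, Het.
  - apply continuity_2d_pt_ext_loc with (f := utx).
    + exists e; intros y s _ Hs; symmetry.
      apply is_derive_unique, Dtx, Het, Hs.
    + apply continuous_slab_interior with T; assumption.
  - apply continuity_2d_pt_ext_loc with (f := uxt).
    + exists e; intros y s _ Hs; symmetry.
      apply is_derive_unique, Dxt, Het, Hs.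
    + apply continuous_slab_interior with T; assumption.
Qed.

Lemma abs_power_ge_0 (p x : R) : 0 <= abs_power p x.
Proof.
  unfold abs_power; destruct (Req_EM_T x 0); [lra |].
  left; apply exp_pos.
Qed.

(* Since [(d_t + d_x) (d_t - d_x) u >= 0], the function [(d_t - d_x) u] increases
   along the lines [x - t = const]; integrating it along [x + t = const] gives
   d'Alembert's formula as an inequality. *)
Lemma dalembert_lower_bound (T : Rbar) (u ux ut uxx uxt utx utt : R -> R -> R)
    (x t : R) :
  Rbar_lt 0 T ->
  C1_slab T u ux ut -> C1_slab T ux uxx uxt -> C1_slab T ut utx utt ->
  (forall y s, slab T (y, s) -> 0 <= utt y s - uxx y s) ->
  (forall y, ut y 0 = 0) ->
  slab T (x, t) -> (u (x - t) 0 + u (x + t) 0) / 2 <= u x t.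
Proof.
  intros HT Cu Cux Cut Hpos Hut [Ht0 HtT]; simpl in Ht0, HtT.
  assert (Hlt : forall s, s <= t -> Rbar_lt s T).
  { intros s Hs. apply Rbar_le_lt_trans with t; [exact Hs | exact HtT]. }
  (* The line of slope [1] through [(y, s)] starts at [(y - s, 0)], where [ut] vanishes. *)
  assert (Hw : forall y s, 0 <= s <= t -> - ux (y - s) 0 <= ut y s - ux y s).
  { intros y s Hs.
    assert (H := le_of_nonneg_derive
      (fun r => ut ((y - s) + 1 * r) r - ux ((y - s) + 1 * r) r) s (proj1 Hs)).
    cbv beta in H.
    replace (y - s + 1 * s) with y in H by ring.
    replace (y - s + 1 * 0) with (y - s) in H by ring.
    rewrite Hut in H.
    enough (0 - ux (y - s) 0 <= ut y s - ux y s) by lra.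
    apply H; clear H.
    - intros r Hr.
      assert (HrT : Rbar_lt r T) by (apply Hlt; lra).
      assert (H1 := is_derive_along_line T ut utx utt (y - s) 1 r Cut (proj1 Hr) HrT).
      assert (H2 := is_derive_along_line T ux uxx uxt (y - s) 1 r Cux (proj1 Hr) HrT).
      eexists; split; [exact (is_derive_minus _ _ _ _ _ H1 H2) |].
      rewrite (mixed_derivatives_eq T u ux ut uxx uxt utx utt _ _ Cu Cux Cut (proj1 Hr) HrT).
      assert (H3 : slab T (y - s + 1 * r, r)) by (split; [left; apply Hr | exact HrT]).
      specialize (Hpos _ _ H3).
      unfold minus, plus, opp; simpl. lra.
    - intros r Hr. apply continuity_pt_minus;
        apply continuity_pt_along_line with T; try assumption;
        try (apply Hlt; lra).
      + apply Cut.
      + apply Cux. }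
  assert (Hux : forall y, is_derive (fun z => u z 0) y (ux y 0)).
  { intros y. apply Cu. split; [apply Rle_refl | exact HT]. }
  (* At the point [(x + t - r, r)] of the other characteristic, [Hw] bounds the slope of [u] below
     by [- ux (x + t - 2 * r) 0]; this exhibits an antiderivative of that bound in [r]. *)
  assert (HD0 : forall r, is_derive (fun r => u (x + t - 2 * r) 0 / 2) r
                            (- ux (x + t - 2 * r) 0)).
  { intros r.
    evar_last.
    - apply (is_derive_ext (fun r => scal (/ 2) (u (x + t - 2 * r) 0))).
      { intros s; unfold scal; simpl; unfold mult; simpl; field. }
      apply is_derive_scal.
      apply (is_derive_comp (fun z => u z 0) (fun r => x + t - 2 * r)).
      + apply Hux.
      + auto_derive; [exact I | reflexivity].
    - unfold scal; simpl; unfold mult; simpl. field. }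
  assert (H := le_of_nonneg_derive
    (fun r => u ((x + t) + (-1) * r) r - u (x + t - 2 * r) 0 / 2) t Ht0).
  cbv beta in H.
  replace (x + t + -1 * t) with x in H by ring.
  replace (x + t + -1 * 0) with (x + t) in H by ring.
  replace (x + t - 2 * t) with (x - t) in H by ring.
  replace (x + t - 2 * 0) with (x + t) in H by ring.
  enough (u (x + t) 0 - u (x + t) 0 / 2 <= u x t - u (x - t) 0 / 2) by lra.
  apply H; clear H.
  - intros r Hr.
    assert (HrT : Rbar_lt r T) by (apply Hlt; lra).
    assert (H1 := is_derive_along_line T u ux ut (x + t) (-1) r Cu (proj1 Hr) HrT).
    eexists; split; [exact (is_derive_minus _ _ _ _ _ H1 (HD0 r)) |].
    assert (H2 := Hw (x + t + -1 * r) r ltac:(lra)).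
    replace (x + t + -1 * r - r) with (x + t - 2 * r) in H2 by ring.
    unfold minus, plus, opp; simpl. lra.
  - intros r Hr. apply continuity_pt_minus.
    + apply continuity_pt_along_line with T; try assumption;
        try (apply Hlt; lra). apply Cu.
    + apply continuity_pt_filterlim.
      apply (continuous_comp (fun r => Rmax 0 r) (fun s => u (x + t - 2 * s) 0 / 2)).
      * apply continuous_Rmax_0.
      * apply @ex_derive_continuous. eexists. apply HD0.
Qed.

(** * Cutoffs and Young's inequality *)

(* The polynomial [cutoff n tau] is nonnegative on [-tau, tau] and vanishes at the
   end points together with its first derivative, so that no truncation is needed. *)
Definition parabola (tau x : R) : R := 1 - (x / tau) ^ 2.

Definition cutoff (n : nat) (tau x : R) : R := parabola tau x ^ S (S n).

Definition cutoff' (n : nat) (tau x : R) : R :=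
  - (2 * INR (S (S n)) * x / tau ^ 2) * parabola tau x ^ S n.

(** With exponent [n + 2] in [cutoff], a factor [parabola tau x ^ n] survives two derivatives. *)
Definition cutoff'' (n : nat) (tau x : R) : R :=
  - (2 * INR (S (S n)) / tau ^ 2) * parabola tau x ^ S n
  + 4 * INR (S (S n)) * INR (S n) * x ^ 2 / tau ^ 4 * parabola tau x ^ n.

Definition cutoff_const (n : nat) : R :=
  2 * INR (S (S n)) + 4 * INR (S (S n)) * INR (S n).

Lemma is_derive_parabola_pow (m : nat) (tau x : R) :
  tau <> 0 ->
  is_derive (fun y => parabola tau y ^ S m) x
    (- (2 * INR (S m) * x / tau ^ 2) * parabola tau x ^ m).
Proof.
  intros Htau. unfold parabola. auto_derive; [exact I |].
  change (match m with 0%nat => 1 | S _ => INR m + 1 end) with (INR (S m)).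
  replace (1 + - (x * / tau * (x * / tau * 1))) with (1 - (x / tau) ^ 2)
    by (unfold Rdiv; ring).
  generalize ((1 - (x / tau) ^ 2) ^ m) (INR (S m)); intros w k.
  field. exact Htau.
Qed.

Lemma is_derive_cutoff (n : nat) (tau x : R) :
  tau <> 0 -> is_derive (cutoff n tau) x (cutoff' n tau x).
Proof. apply is_derive_parabola_pow. Qed.

Lemma is_derive_cutoff' (n : nat) (tau x : R) :
  tau <> 0 -> is_derive (cutoff' n tau) x (cutoff'' n tau x).
Proof.
  intros Htau. unfold cutoff', cutoff''.
  evar_last.
  - apply (is_derive_mult (fun y => - (2 * INR (S (S n)) * y / tau ^ 2))
             (fun y => parabola tau y ^ S n) x (- (2 * INR (S (S n)) / tau ^ 2))).
    + generalize (INR (S (S n))); intros k.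
      auto_derive; [exact I | field; exact Htau].
    + apply is_derive_parabola_pow, Htau.
    + intros a b; apply Rmult_comm.
  - generalize (parabola tau x ^ S n) (parabola tau x ^ n) (INR (S (S n))) (INR (S n)).
    intros P Q k k'. unfold plus, mult; simpl. field. exact Htau.
Qed.

Lemma continuous_cutoff (n : nat) (tau x : R) :
  tau <> 0 -> continuous (cutoff n tau) x.
Proof.
  intros H. apply @ex_derive_continuous. eexists. apply is_derive_cutoff, H.
Qed.

Lemma continuous_cutoff' (n : nat) (tau x : R) :
  tau <> 0 -> continuous (cutoff' n tau) x.
Proof.
  intros H. apply @ex_derive_continuous. eexists. apply is_derive_cutoff', H.
Qed.

Lemma continuous_cutoff'' (n : nat) (tau x : R) :
  tau <> 0 -> continuous (cutoff'' n tau) x.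
Proof.
  intros H. apply @ex_derive_continuous. unfold cutoff'', parabola.
  auto_derive. repeat split; exact H.
Qed.

Lemma parabola_le (tau x y : R) :
  0 < tau -> Rabs x <= Rabs y -> parabola tau y <= parabola tau x.
Proof.
  intros Ht H. unfold parabola, Rdiv. rewrite !Rpow_mult_distr.
  assert (Hp := pow_lt _ 2 (Rinv_0_lt_compat _ Ht)).
  assert (Hs : x ^ 2 <= y ^ 2).
  { rewrite <- (pow2_abs x), <- (pow2_abs y). apply pow_incr; split; [apply Rabs_pos | exact H]. }
  nra.
Qed.

Lemma parabola_bounds (tau x : R) :
  0 < tau -> Rabs x <= tau -> 0 <= parabola tau x <= 1.
Proof.
  intros Ht H. split.
  - replace 0 with (parabola tau tau).
    + apply parabola_le; [exact Ht |]. rewrite (Rabs_pos_eq tau); lra.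
    + unfold parabola. field. lra.
  - replace 1 with (parabola tau 0).
    + apply parabola_le; [exact Ht |]. rewrite Rabs_R0; apply Rabs_pos.
    + unfold parabola. field. lra.
Qed.

Lemma cutoff_bounds (n : nat) (tau x : R) :
  0 < tau -> Rabs x <= tau -> 0 <= cutoff n tau x <= 1.
Proof.
  intros Ht H. destruct (parabola_bounds tau x Ht H) as [H0 H1]. unfold cutoff. split.
  - apply pow_le, H0.
  - rewrite <- (pow1 (S (S n))). apply pow_incr; split; assumption.
Qed.

Lemma cutoff_const_pos (n : nat) : 0 < cutoff_const n.
Proof.
  unfold cutoff_const. rewrite !S_INR. assert (H := pos_INR n). nra.
Qed.

(** Both [parabola tau x] and [(x / tau) ^ 2] lie in [[0, 1]], so only the coefficients, summed in
    [cutoff_const], remain. The power of [parabola] is kept because Young's inequality needs it as a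
    weight. *)
Lemma cutoff''_bound (n : nat) (tau x : R) :
  0 < tau -> Rabs x <= tau ->
  Rabs (cutoff'' n tau x) <= cutoff_const n / tau ^ 2 * parabola tau x ^ n.
Proof.
  intros Ht H. destruct (parabola_bounds tau x Ht H) as [H0 H1].
  assert (Hn := pow_le _ n H0).
  assert (HT := pow_lt _ 2 Ht).
  assert (Hx : 0 <= (x / tau) ^ 2 <= 1) by (unfold parabola in H0; split; [apply pow2_ge_0 | lra]).
  unfold cutoff''.
  replace (4 * INR (S (S n)) * INR (S n) * x ^ 2 / tau ^ 4 * parabola tau x ^ n)
    with (4 * INR (S (S n)) * INR (S n) / tau ^ 2 * ((x / tau) ^ 2 * parabola tau x ^ n))
    by (field; lra).
  unfold cutoff_const. rewrite <- (tech_pow_Rmult (parabola tau x) n).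
  assert (Hk := pos_INR (S (S n))). assert (Hk' := pos_INR (S n)).
  set (k := INR (S (S n))) in *. set (k' := INR (S n)) in *.
  set (y := (x / tau) ^ 2) in *. set (w := parabola tau x) in *. set (N := w ^ n) in *.
  replace (- (2 * k / tau ^ 2) * (w * N)) with (/ tau ^ 2 * - (2 * k * (w * N)))
    by (field; lra).
  replace (4 * k * k' / tau ^ 2 * (y * N)) with (/ tau ^ 2 * (4 * k * k' * (y * N)))
    by (field; lra).
  replace ((2 * k + 4 * k * k') / tau ^ 2 * N)
    with (/ tau ^ 2 * (2 * k * N + 4 * k * k' * N)) by (field; lra).
  rewrite <- Rmult_plus_distr_l, Rabs_mult, (Rabs_pos_eq (/ tau ^ 2))
    by (left; apply Rinv_0_lt_compat, HT).
  apply Rmult_le_compat_l; [left; apply Rinv_0_lt_compat, HT |].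
  assert (Hkk : 0 <= k * k') by (apply Rmult_le_pos; assumption).
  assert (A1 : 0 <= w * N <= N) by nra.
  assert (A2 : 0 <= y * N <= N) by nra.
  assert (A3 : k * (w * N) <= k * N) by (apply Rmult_le_compat_l; lra).
  assert (A4 : k * k' * (y * N) <= k * k' * N) by (apply Rmult_le_compat_l; lra).
  assert (A5 : 0 <= k * (w * N)) by (apply Rmult_le_pos; lra).
  assert (A6 : 0 <= k * k' * (y * N)) by (apply Rmult_le_pos; lra).
  apply Rabs_le; lra.
Qed.

(* Young's inequality with weight: either [b <= |u|^(p-1) w^2 / 4], or [|u| w^(2 q)]
   is bounded by a power of [b]. *)
Lemma weighted_young (p q u w b : R) (n : nat) :
  1 < p -> q = / (p - 1) -> 2 * q <= INR n -> (0 < n)%nat ->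
  0 <= w <= 1 -> 0 < b ->
  Rabs u * b * w ^ n <= / 4 * abs_power p u * w ^ S (S n) + b * Rpower (4 * b) q.
Proof.
  intros Hp Hq Hqn Hn Hw Hb.
  assert (Hq0 : 0 < q) by (rewrite Hq; apply Rinv_0_lt_compat; lra).
  assert (HE : 0 < b * Rpower (4 * b) q) by (apply Rmult_lt_0_compat; [exact Hb | apply exp_pos]).
  assert (HP := abs_power_ge_0 p u).
  assert (HwS := pow_le w (S (S n)) (proj1 Hw)).
  assert (HPw := Rmult_le_pos _ _ HP HwS).
  destruct (Req_dec w 0) as [-> | Hw0].
  (* Here [0 < n] makes the left side vanish; from now on [w] has a logarithm. *)
  { rewrite pow_i by exact Hn. lra. }
  assert (Hwp : 0 < w) by lra.
  revert HP HPw. unfold abs_power. destruct (Req_EM_T u 0) as [-> | Hu]; intros HP HPw.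
  { rewrite Rabs_R0. lra. }
  assert (Ha : 0 < Rabs u) by (apply Rabs_pos_lt, Hu).
  set (a := Rabs u) in *.
  replace (Rpower a p) with (a * Rpower a (p - 1)) in *
    by (rewrite <- (Rpower_1 a) at 1 by exact Ha; rewrite <- Rpower_plus; f_equal; ring).
  assert (Hwn := pow_lt w n Hwp).
  destruct (Rle_lt_dec (4 * b) (Rpower a (p - 1) * w ^ 2)) as [H | H].
  - replace (/ 4 * (a * Rpower a (p - 1)) * w ^ S (S n))
      with (/ 4 * (a * w ^ n) * (Rpower a (p - 1) * w ^ 2)) by (simpl; ring).
    assert (0 < a * w ^ n) by (apply Rmult_lt_0_compat; assumption).
    nra.
  (* Raising [a^(p-1) w^2 < 4 b] to the power [q] gives [a w^(2q) <= (4 b)^q], and [w^n <= w^(2q)]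
     because [w <= 1] and [2 q <= n]. *)
  - assert (H1 : a * w ^ n <= Rpower (4 * b) q).
    { apply Rle_trans with (Rpower (Rpower a (p - 1) * w ^ 2) q).
      - rewrite <- Rpower_mult_distr by (try apply exp_pos; apply pow_lt, Hwp).
        rewrite <- (Rpower_pow 2 w Hwp), !Rpower_mult.
        replace ((p - 1) * q) with 1 by (rewrite Hq; field; lra).
        rewrite Rpower_1 by exact Ha.
        apply Rmult_le_compat_l; [lra |].
        rewrite <- (Rpower_pow n w Hwp). simpl (INR 2).
        assert (Hln : ln w <= 0) by (rewrite <- ln_1; apply ln_le; lra).
        assert (Hle : INR n * ln w <= (1 + 1) * q * ln w) by nra.
        unfold Rpower. destruct Hle as [Hle | ->]; [left; apply exp_increasing, Hle | right; reflexivity].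
      - apply Rle_Rpower_l; [lra |]. split; [| lra].
        apply Rmult_lt_0_compat; [apply exp_pos | apply pow_lt, Hwp]. }
    nra.
Qed.

(** Young's inequality is used once with the weight in [x] and once with the weight in [t]. Each use
    absorbs a quarter of the nonlinear term and costs one error term, since the undifferentiated
    cutoff is at most [1]. *)
Lemma integrand_lower_bound (p q tau v x t : R) (n : nat) :
  1 < p -> q = / (p - 1) -> 2 * q <= INR n -> (0 < n)%nat ->
  0 < tau -> Rabs x <= tau -> Rabs t <= tau ->
  / 2 * (abs_power p v * (cutoff n tau x * cutoff n tau t))
    - 2 * (cutoff_const n / tau ^ 2 * Rpower (4 * (cutoff_const n / tau ^ 2)) q)
  <= abs_power p v * (cutoff n tau x * cutoff n tau t)
     + v * (cutoff'' n tau x * cutoff n tau t - cutoff n tau x * cutoff'' n tau t).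
Proof.
  intros Hp Hq Hqn Hn Htau Hx Ht.
  assert (Hb : 0 < cutoff_const n / tau ^ 2).
  { apply Rdiv_lt_0_compat; [apply cutoff_const_pos | apply pow_lt, Htau]. }
  set (b := cutoff_const n / tau ^ 2) in *.
  assert (HE : 0 < b * Rpower (4 * b) q) by (apply Rmult_lt_0_compat; [exact Hb | apply exp_pos]).
  assert (Hterm : forall y s, Rabs y <= tau -> Rabs s <= tau ->
    Rabs (v * (cutoff'' n tau y * cutoff n tau s)) <=
    / 4 * (abs_power p v * (cutoff n tau y * cutoff n tau s)) + b * Rpower (4 * b) q).
  { intros y s Hy Hs.
    destruct (cutoff_bounds n tau s Htau Hs) as [C0 C1].
    assert (HY := weighted_young p q v (parabola tau y) b n Hp Hq Hqn Hn
                    (parabola_bounds tau y Htau Hy) Hb).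
    fold (cutoff n tau y) in HY.
    rewrite !Rabs_mult, (Rabs_pos_eq _ C0).
    apply Rle_trans with ((Rabs v * (b * parabola tau y ^ n)) * cutoff n tau s).
    - rewrite <- Rmult_assoc. apply Rmult_le_compat_r; [exact C0 |].
      apply Rmult_le_compat_l; [apply Rabs_pos | apply cutoff''_bound; assumption].
    - set (E := b * Rpower (4 * b) q) in *. nra. }
  assert (H1 := Hterm x t Hx Ht).
  assert (H2 := Hterm t x Ht Hx).
  apply Rabs_le_between in H1. apply Rabs_le_between in H2.
  nra.
Qed.

(** * The weighted momentum *)

Lemma RInt_ge_const (h : R -> R) (a b m : R) :
  a <= b -> ex_RInt h a b -> (forall x, a < x < b -> m <= h x) ->
  m * (b - a) <= RInt h a b.
Proof.
  intros Hab Hex Hm.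
  replace (m * (b - a)) with (RInt (fun _ => m) a b).
  - apply RInt_le; try assumption. apply ex_RInt_const.
  - rewrite RInt_const. unfold scal; simpl; unfold mult; simpl. ring.
Qed.

(** Here [m] serves as a baseline, later the negative Young error, and [M] as the gain on a window;
    [l = r] covers the case without gain. *)
Lemma RInt_ge_bump (h : R -> R) (a b l r m M : R) :
  a <= l -> l <= r -> r <= b ->
  (forall x, continuous h x) ->
  (forall x, a <= x <= b -> m <= h x) ->
  (forall x, l <= x <= r -> m + M <= h x) ->
  m * (b - a) + M * (r - l) <= RInt h a b.
Proof.
  intros Hal Hlr Hrb Hc Hm HM.
  assert (Hex : forall c d, ex_RInt h c d).
  { intros c d. apply @ex_RInt_continuous. intros x _; apply Hc. }
  rewrite <- (RInt_Chasles h a l b), <- (RInt_Chasles h l r b) by apply Hex.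
  assert (H1 : m * (l - a) <= RInt h a l).
  { apply RInt_ge_const; [lra | apply Hex | intros; apply Hm; lra]. }
  assert (H2 : (m + M) * (r - l) <= RInt h l r).
  { apply RInt_ge_const; [lra | apply Hex | intros; apply HM; lra]. }
  assert (H3 : m * (b - r) <= RInt h r b).
  { apply RInt_ge_const; [lra | apply Hex | intros; apply Hm; lra]. }
  unfold plus; simpl. lra.
Qed.

(** The hypothesis on squares covers both end points [tau] and [- tau]. *)
Lemma cutoff_tau (n : nat) (tau x : R) :
  tau <> 0 -> x ^ 2 = tau ^ 2 -> cutoff n tau x = 0 /\ cutoff' n tau x = 0.
Proof.
  intros Htau Hx.
  assert (Hw : parabola tau x = 0).
  { unfold parabola, Rdiv. rewrite Rpow_mult_distr, Hx. field. exact Htau. }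
  unfold cutoff, cutoff'. rewrite Hw. split; simpl; ring.
Qed.

Lemma cutoff_0 (n : nat) (tau : R) :
  tau <> 0 -> cutoff n tau 0 = 1 /\ cutoff' n tau 0 = 0.
Proof.
  intros Htau.
  assert (Hw : parabola tau 0 = 1) by (unfold parabola; field; exact Htau).
  unfold cutoff, cutoff'. rewrite Hw, !pow1. split; [reflexivity | field; exact Htau].
Qed.

(** Green's identity: the integrand is the derivative of [v' * cutoff - v * cutoff'], which vanishes
    at both ends. *)
Lemma RInt_cutoff_by_parts (n : nat) (tau : R) (v v' v'' : R -> R) :
  0 < tau ->
  (forall x, is_derive v x (v' x)) -> (forall x, is_derive v' x (v'' x)) ->
  (forall x, continuous v'' x) ->
  is_RInt (fun x => v'' x * cutoff n tau x - v x * cutoff'' n tau x) (- tau) tau 0.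
Proof.
  intros Htau H1 H2 H3.
  assert (Htau' : tau <> 0) by lra.
  destruct (cutoff_tau n tau tau Htau' eq_refl) as [E1 E2].
  destruct (cutoff_tau n tau (- tau) Htau' ltac:(ring)) as [E3 E4].
  assert (Hcv : forall x, continuous v x).
  { intros x. apply @ex_derive_continuous. eexists. apply H1. }
  evar_last.
  - apply (is_RInt_derive (fun x => v' x * cutoff n tau x - v x * cutoff' n tau x)).
    + intros x _.
      assert (D := is_derive_minus _ _ _ _ _
        (is_derive_mult _ _ _ _ _ (H2 x) (is_derive_cutoff n tau x Htau') Rmult_comm)
        (is_derive_mult _ _ _ _ _ (H1 x) (is_derive_cutoff' n tau x Htau') Rmult_comm)).
      evar_last; [exact D |].
      unfold minus, plus, opp, mult; simpl; ring.
    + intros x _.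
      apply @continuous_minus; apply @continuous_mult; try apply H3; try apply Hcv;
        try (apply continuous_cutoff; exact Htau');
        apply continuous_cutoff''; exact Htau'.
  - rewrite E1, E2, E3, E4. unfold minus, plus, opp; simpl; ring.
Qed.

(** The boundary term left by two integrations by parts in time of [utt] against the product of the
    cutoffs, called [J(t)] above. *)
Definition weighted_momentum (n : nat) (tau : R) (u ut : R -> R -> R) (t : R) : R :=
  RInt (fun x => (ut x t * cutoff n tau t - u x t * cutoff' n tau t) * cutoff n tau x)
    (- tau) tau.

(** The differential inequality for [J] in integrated form. The window [[l t, l t + L]] may move
    with [t], so that it can follow a characteristic; [L = M = 0] leaves only the Young error. *)
Lemma weighted_momentum_increment (p q tau c d L M : R) (n : nat) (T : Rbar)
    (u ux ut uxx uxt utx utt : R -> R -> R) (l : R -> R) :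
  1 < p -> q = / (p - 1) -> 2 * q <= INR n -> (0 < n)%nat ->
  C1_slab T u ux ut -> C1_slab T ux uxx uxt -> C1_slab T ut utx utt ->
  (forall x t, slab T (x, t) -> utt x t - uxx x t = abs_power p (u x t)) ->
  0 <= c -> c < d -> d <= tau -> Rbar_lt tau T -> 0 <= L ->
  (forall t, c <= t <= d -> - tau <= l t /\ l t + L <= tau) ->
  (forall x t, c <= t <= d -> l t <= x <= l t + L ->
     M <= / 2 * (abs_power p (u x t) * (cutoff n tau x * cutoff n tau t))) ->
  (d - c) * (L * M - 4 * tau *
     (cutoff_const n / tau ^ 2 * Rpower (4 * (cutoff_const n / tau ^ 2)) q))
  <= weighted_momentum n tau u ut d - weighted_momentum n tau u ut c.
Proof.
  intros Hp Hq Hqn Hn Cu Cux Cut Heq Hc Hcd Hd HT HL Hl HM.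
  assert (Htau : 0 < tau) by lra.
  assert (Htau' : tau <> 0) by lra.
  assert (H0T : Rbar_lt 0 T) by (apply Rbar_lt_trans with tau; assumption).
  assert (Hlt : forall s, s <= tau -> Rbar_lt s T).
  { intros s Hs. apply Rbar_le_lt_trans with tau; [exact Hs | exact HT]. }
  assert (C2 : forall (h : R -> R) x t, (forall y, continuous h y) ->
             continuity_2d_pt (fun y _ => h y) x t).
  { intros h x t Hh. apply (continuity_1d_2d_pt_comp h (fun y _ => y)).
    - apply continuity_pt_filterlim, Hh.
    - apply continuity_2d_pt_id1. }
  assert (C2' : forall (h : R -> R) x t, (forall y, continuous h y) ->
             continuity_2d_pt (fun _ s => h s) x t).
  { intros h x t Hh. apply (continuity_1d_2d_pt_comp h (fun _ s => s)).
    - apply continuity_pt_filterlim, Hh.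
    - apply continuity_2d_pt_id2. }
  set (E := cutoff_const n / tau ^ 2 * Rpower (4 * (cutoff_const n / tau ^ 2)) q).
  (* Only [u] and [ut] need the clamp in time, the cutoffs being polynomials on the whole line. *)
  destruct (RInt_param_mvt T
    (fun x t => (ut x (Rmax 0 t) * cutoff n tau t - u x (Rmax 0 t) * cutoff' n tau t)
                  * cutoff n tau x)
    (fun x t => (utt x t * cutoff n tau t - u x t * cutoff'' n tau t) * cutoff n tau x)
    (- tau) tau c d) as [xi [Hxi Exi]]; try lra.
  - apply Hlt, Hd.
  - intros x t Ht.
    apply continuity_2d_pt_mult;
      [apply continuity_2d_pt_minus; apply continuity_2d_pt_mult |].
    + apply continuous_slab_clamp with T; [exact H0T | apply Cut | exact Ht].
    + apply C2'; intros; apply continuous_cutoff, Htau'.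
    + apply continuous_slab_clamp with T; [exact H0T | apply Cu | exact Ht].
    + apply C2'; intros; apply continuous_cutoff', Htau'.
    + apply C2; intros; apply continuous_cutoff, Htau'.
  - intros x t Hct Ht.
    assert (Ht0 : 0 < t) by lra.
    apply is_derive_ext_loc with
      (f := fun t => (ut x t * cutoff n tau t - u x t * cutoff' n tau t) * cutoff n tau x).
    { apply filter_imp with (2 := open_gt 0 t Ht0).
      intros r Hr. rewrite Rmax_right by lra. reflexivity. }
    assert (D1 := is_Dt_interior T u ut x t (proj1 (proj2 Cu)) Ht0 Ht).
    assert (D2 := is_Dt_interior T ut utt x t (proj1 (proj2 Cut)) Ht0 Ht).
    assert (D3 := is_derive_cutoff n tau t Htau').
    assert (D4 := is_derive_cutoff' n tau t Htau').
    (* The two products [ut * cutoff'] cancel, which leaves [utt * cutoff - u * cutoff'']. *)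
    assert (D5 := is_derive_minus _ _ _ _ _
                    (is_derive_mult _ _ _ _ _ D2 D3 Rmult_comm)
                    (is_derive_mult _ _ _ _ _ D1 D4 Rmult_comm)).
    evar_last.
    + apply (is_derive_ext (fun t => scal (cutoff n tau x)
               (ut x t * cutoff n tau t - u x t * cutoff' n tau t))).
      { intros s; unfold scal; simpl; unfold mult; simpl; ring. }
      apply is_derive_scal, D5.
    + unfold scal, minus, plus, opp, mult; simpl; unfold mult; simpl. ring.
  - intros x t Hct Ht.
    assert (Ht0 : 0 < t) by lra.
    apply continuity_2d_pt_mult;
      [apply continuity_2d_pt_minus; apply continuity_2d_pt_mult |].
    + apply continuous_slab_interior with T; [apply Cut | exact Ht0 | exact Ht].
    + apply C2'; intros; apply continuous_cutoff, Htau'.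
    + apply continuous_slab_interior with T; [apply Cu | exact Ht0 | exact Ht].
    + apply C2'; intros; apply continuous_cutoff'', Htau'.
    + apply C2; intros; apply continuous_cutoff, Htau'.
  - rewrite (Rmax_right 0 c), (Rmax_right 0 d) in Exi by lra.
    change (weighted_momentum n tau u ut d - weighted_momentum n tau u ut c =
      (d - c) * RInt (fun x => (utt x xi * cutoff n tau xi - u x xi * cutoff'' n tau xi)
                        * cutoff n tau x) (- tau) tau) in Exi.
    rewrite Exi. apply Rmult_le_compat_l; [lra |].
    assert (Hs : forall x, slab T (x, xi)).
    { intros x; split; simpl; [lra | apply Hlt; lra]. }
    assert (Ku : forall x, continuous (fun y => u y xi) x).
    { intros x. apply continuous_slab_slice with T; [apply Cu | apply Hs]. }
    assert (Kutt : forall x, continuous (fun y => utt y xi) x).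
    { intros x. apply continuous_slab_slice with T; [apply Cut | apply Hs]. }
    assert (Kuxx : forall x, continuous (fun y => uxx y xi) x).
    { intros x. apply continuous_slab_slice with T; [apply Cux | apply Hs]. }
    assert (Hparts := RInt_cutoff_by_parts n tau (fun y => u y xi) (fun y => ux y xi)
                        (fun y => uxx y xi) Htau
                        (fun x => proj1 Cu x xi (Hs x)) (fun x => proj1 Cux x xi (Hs x)) Kuxx).
    set (h1 := fun x => (utt x xi * cutoff n tau xi - u x xi * cutoff'' n tau xi)
                          * cutoff n tau x).
    set (h2 := fun x => uxx x xi * cutoff n tau x - u x xi * cutoff'' n tau x) in Hparts.
    assert (Kh1 : forall x, continuous h1 x).
    { intros x. apply @continuous_mult; [| apply continuous_cutoff, Htau'].
      apply @continuous_minus; apply @continuous_mult;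
        try apply Kutt; try apply Ku; apply continuous_const. }
    assert (Kh2 : forall x, continuous h2 x).
    { intros x. apply @continuous_minus; apply @continuous_mult;
        try apply Kuxx; try apply Ku;
        try (apply continuous_cutoff, Htau'); apply continuous_cutoff'', Htau'. }
    assert (Kh : forall x, continuous (fun x => minus (h1 x) (scal (cutoff n tau xi) (h2 x))) x).
    { intros x. apply @continuous_minus; [apply Kh1 |].
      apply @continuous_scal_r, Kh2. }
    assert (Hex1 : ex_RInt h1 (- tau) tau).
    { apply @ex_RInt_continuous; intros; apply Kh1. }
    (* Subtracting a multiple of [h2], whose integral is [0], turns [utt] into [utt - uxx], hence
       into the nonlinear term. *)
    assert (Erw : RInt h1 (- tau) tau =
              RInt (fun x => minus (h1 x) (scal (cutoff n tau xi) (h2 x))) (- tau) tau).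
    { symmetry. apply is_RInt_unique.
      evar_last.
      - apply @is_RInt_minus; [exact (RInt_correct _ _ _ Hex1) |].
        apply @is_RInt_scal, Hparts.
      - unfold minus, plus, opp, scal; simpl; unfold mult; simpl; ring. }
    rewrite Erw.
    assert (Hid : forall x, minus (h1 x) (scal (cutoff n tau xi) (h2 x)) =
      abs_power p (u x xi) * (cutoff n tau x * cutoff n tau xi)
      + u x xi * (cutoff'' n tau x * cutoff n tau xi - cutoff n tau x * cutoff'' n tau xi)).
    { intros x. rewrite <- (Heq x xi (Hs x)). unfold h1, h2, minus, plus, opp, scal; simpl.
      unfold mult; simpl. ring. }
    assert (Hlow : forall x, - tau <= x <= tau ->
      / 2 * (abs_power p (u x xi) * (cutoff n tau x * cutoff n tau xi)) - 2 * E <=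
      minus (h1 x) (scal (cutoff n tau xi) (h2 x))).
    { intros x Hx. rewrite Hid. apply integrand_lower_bound; try assumption.
      - apply Rabs_le; lra.
      - apply Rabs_le; lra. }
    destruct (Hl xi Hxi) as [Hl1 Hl2].
    (* The baseline [- 2 E] over an interval of length [2 tau] gives the error [- 4 tau E]; the gain
       [M] acts on the window of length [L]. *)
    apply Rle_trans with ((- (2 * E)) * (tau - - tau) + M * (l xi + L - l xi)); [right; ring |].
    apply RInt_ge_bump; try lra.
    + exact Kh.
    + intros x Hx. apply Rle_trans with (2 := Hlow x Hx).
      destruct (cutoff_bounds n tau x Htau ltac:(apply Rabs_le; lra)) as [C0 _].
      destruct (cutoff_bounds n tau xi Htau ltac:(apply Rabs_le; lra)) as [C0' _].
      assert (HP := Rmult_le_pos _ _ (abs_power_ge_0 p (u x xi)) (Rmult_le_pos _ _ C0 C0')).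
      lra.
    + intros x Hx. apply Rle_trans with (2 := Hlow x ltac:(lra)).
      assert (HM' := HM x xi Hxi Hx). lra.
Qed.

(** * The two lifespan bounds *)

Lemma weighted_momentum_0 (n : nat) (tau : R) (u ut : R -> R -> R) :
  tau <> 0 ->
  weighted_momentum n tau u ut 0 = RInt (fun x => ut x 0 * cutoff n tau x) (- tau) tau.
Proof.
  intros Htau. unfold weighted_momentum.
  destruct (cutoff_0 n tau Htau) as [-> ->].
  apply RInt_ext; intros x _; simpl. ring.
Qed.

Lemma weighted_momentum_tau (n : nat) (tau : R) (u ut : R -> R -> R) :
  tau <> 0 -> weighted_momentum n tau u ut tau = 0.
Proof.
  intros Htau. unfold weighted_momentum.
  destruct (cutoff_tau n tau tau Htau eq_refl) as [-> ->].
  rewrite (RInt_ext _ (fun _ => 0)) by (intros; simpl; ring).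
  rewrite RInt_const. unfold scal; simpl; unfold mult; simpl. ring.
Qed.

(** The space-time area [tau^2] cancels the [tau^(-2)] of the second derivatives, so the total error
    decays only through the Young factor. *)
Lemma young_error_scaling (K tau q : R) :
  0 < K -> 0 < tau ->
  4 * tau ^ 2 * (K / tau ^ 2 * Rpower (4 * (K / tau ^ 2)) q) =
  4 * K * Rpower (4 * K) q * Rpower tau (- (2 * q)).
Proof.
  intros HK Ht.
  replace (4 * (K / tau ^ 2)) with ((4 * K) * Rpower tau (- (2))).
  - rewrite <- Rpower_mult_distr, Rpower_mult by (try apply exp_pos; lra).
    replace (- (2) * q) with (- (2 * q)) by ring. field. lra.
  - rewrite Rpower_Ropp. replace 2 with (INR 2) at 1 by reflexivity.
    rewrite Rpower_pow by exact Ht. field. lra.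
Qed.

Lemma le_Rpower_of_decay (y D a tau : R) :
  0 < y -> 0 < D -> 0 < a -> 0 < tau -> y <= D * Rpower tau (- a) ->
  tau <= Rpower D (/ a) * Rpower y (- / a).
Proof.
  intros Hy HD Ha Ht H.
  assert (H1 : Rpower tau a <= D * / y).
  { rewrite Rpower_Ropp in H.
    assert (Hp : 0 < Rpower tau a) by apply exp_pos.
    apply Rmult_le_reg_r with y; [exact Hy |].
    rewrite Rmult_assoc, Rinv_l, Rmult_1_r by lra.
    apply Rmult_le_reg_l with (/ Rpower tau a); [apply Rinv_0_lt_compat, Hp |].
    rewrite <- Rmult_assoc, Rinv_l by lra. lra. }
  replace tau with (Rpower (Rpower tau a) (/ a)).
  - replace (Rpower y (- / a)) with (Rpower (/ y) (/ a)).
    + rewrite Rpower_mult_distr by (try apply Rinv_0_lt_compat; assumption).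
      apply Rle_Rpower_l.
      * left; apply Rinv_0_lt_compat, Ha.
      * split; [apply exp_pos | exact H1].
    + unfold Rpower. rewrite ln_Rinv by exact Hy. f_equal. ring.
  - rewrite Rpower_mult, Rinv_r, Rpower_1 by lra. reflexivity.
Qed.

(** Each admissible [tau] in [[tau0, T)] is bounded by inverting the decay estimate. The threshold
    [tau0] goes into the constant because [eps <= 1] makes the power of [eps] at least [1]. *)
Lemma Rbar_le_of_decay (T : Rbar) (tau0 D a s eps : R) :
  0 < tau0 -> 0 < D -> 0 < a -> 0 < s -> 0 < eps <= 1 ->
  (forall tau : R, tau0 <= tau -> Rbar_lt tau T ->
     Rpower eps s <= D * Rpower tau (- a)) ->
  Rbar_le T ((tau0 + Rpower D (/ a)) * Rpower eps (- (s / a))).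
Proof.
  intros Ht0 HD Ha Hs Heps H.
  set (X := Rpower eps (- (s / a))).
  assert (HX : 1 <= X).
  { unfold X, Rpower. rewrite <- exp_0 at 1.
    assert (Hsa : 0 < s / a) by (apply Rdiv_lt_0_compat; assumption).
    assert (Hln : ln eps <= 0) by (rewrite <- ln_1; apply ln_le; lra).
    assert (Hle : 0 <= - (s / a) * ln eps) by nra.
    destruct Hle as [Hle | <-]; [left; apply exp_increasing, Hle | right; reflexivity]. }
  assert (HDa : 0 < Rpower D (/ a)) by apply exp_pos.
  set (B := (tau0 + Rpower D (/ a)) * X).
  (* If [T] exceeded [B], a test time strictly between them would exist: the midpoint for finite
     [T], [B + 1] for infinite [T]. *)
  assert (HB : forall tau, B < tau -> Rbar_lt tau T -> False).
  { intros tau HBt HT.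
    assert (Htau : tau0 <= tau) by (unfold B in HBt; nra).
    assert (HH := le_Rpower_of_decay (Rpower eps s) D a tau (exp_pos _) HD Ha ltac:(lra) (H tau Htau HT)).
    rewrite Rpower_mult in HH.
    replace (s * - / a) with (- (s / a)) in HH by (unfold Rdiv; ring).
    fold X in HH. unfold B in HBt. nra. }
  destruct T as [T | |]; simpl.
  - destruct (Rle_lt_dec T B) as [Hle | Hlt]; [exact Hle |].
    exfalso. apply (HB ((B + T) / 2)); simpl; lra.
  - apply (HB (B + 1)); simpl; [lra | exact I].
  - exact I.
Qed.

Lemma exists_pos_nat_ge (r : R) : exists n : nat, (0 < n)%nat /\ r <= INR n.
Proof.
  destruct (INR_unbounded r) as [n Hn].
  exists (S n); split; [lia | rewrite S_INR; lra].
Qed.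

Lemma support2_vanish (f g : R -> R) (R0 x : R) :
  included (support2 f g) (fun x => Rabs x <= R0) -> R0 < Rabs x -> f x = 0 /\ g x = 0.
Proof.
  intros Hsupp Hx.
  destruct (classic (f x <> 0 \/ g x <> 0)) as [H | H].
  - assert (Hs : support2 f g x).
    { intros V [d Hd]. exists x; split; [| exact H].
      apply Hd. unfold disc. rewrite Rminus_diag, Rabs_R0. apply cond_pos. }
    apply Hsupp in Hs. lra.
  - split; apply NNPP; tauto.
Qed.

Lemma is_RInt_vanish_outside (h : R -> R) (R0 a b : R) :
  (forall x, continuous h x) -> (forall x, R0 < Rabs x -> h x = 0) ->
  a <= - R0 -> - R0 <= R0 -> R0 <= b ->
  is_RInt h a b (RInt h (- R0) R0).
Proof.
  intros Hc Hv Ha HR Hb.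
  assert (Hzero : forall c d, c <= d -> (forall x, c < x < d -> h x = 0) -> is_RInt h c d 0).
  { intros c d Hcd Hz.
    apply is_RInt_ext with (f := fun _ => 0).
    - intros x Hx. rewrite Rmin_left, Rmax_right in Hx by exact Hcd. symmetry; apply Hz, Hx.
    - evar_last; [apply is_RInt_const |]. unfold scal; simpl; unfold mult; simpl; ring. }
  assert (H1 : is_RInt h a (- R0) 0).
  { apply Hzero; [exact Ha |]. intros x Hx. apply Hv.
    rewrite Rabs_left by lra. lra. }
  assert (H2 : is_RInt h R0 b 0).
  { apply Hzero; [exact Hb |]. intros x Hx. apply Hv.
    rewrite Rabs_pos_eq by lra. lra. }
  assert (H3 : is_RInt h (- R0) R0 (RInt h (- R0) R0)).
  { apply (RInt_correct (V := R_CompleteNormedModule)), @ex_RInt_continuous. intros; apply Hc. }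
  evar_last; [exact (is_RInt_Chasles _ _ _ _ _ _ (is_RInt_Chasles _ _ _ _ _ _ H1 H3) H2) |].
  unfold plus; simpl; ring.
Qed.

(** Once [[a, b]] contains [[- R0, R0]], the integral over it no longer depends on [a] and [b]. *)
Lemma RInt_gen_vanish_outside (h : R -> R) (R0 : R) :
  0 < R0 -> (forall x, continuous h x) -> (forall x, R0 < Rabs x -> h x = 0) ->
  RInt_gen h (Rbar_locally m_infty) (Rbar_locally p_infty) = RInt h (- R0) R0.
Proof.
  intros HR Hc Hv.
  apply @is_RInt_gen_unique; try apply Proper_StrongProper; try apply Rbar_locally_filter.
  intros P HP.
  apply Filter_prod with (Q := fun x => x < - R0) (R := fun x => R0 < x).
  - exists (- R0); intros x Hx; exact Hx.
  - exists R0; intros x Hx; exact Hx.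
  - intros x y Hx Hy. exists (RInt h (- R0) R0); split.
    + apply is_RInt_vanish_outside; simpl; try assumption; lra.
    + exact (locally_singleton _ _ HP).
Qed.

Lemma bernoulli_le (k : nat) (s : R) : 0 <= s <= 1 -> 1 - INR k * s <= (1 - s) ^ k.
Proof.
  intros Hs. induction k as [| k IH].
  - simpl. lra.
  - rewrite S_INR. simpl.
    assert (H := pos_INR k).
    assert (H1 : (1 - s) * (1 - INR k * s) <= (1 - s) * (1 - s) ^ k)
      by (apply Rmult_le_compat_l; lra).
    nra.
Qed.

(** The parabola is smallest at the edge [r], where Bernoulli's inequality applies with
    [s = (r / tau) ^ 2]. *)
Lemma cutoff_ge (n : nat) (tau x r : R) :
  0 < tau -> Rabs x <= r -> r <= tau ->
  1 - INR (S (S n)) * (r / tau) ^ 2 <= cutoff n tau x.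
Proof.
  intros Ht Hx Hr.
  assert (Hr0 : 0 <= r) by (apply Rle_trans with (2 := Hx), Rabs_pos).
  assert (Hb : 0 <= parabola tau r <= 1)
    by (apply parabola_bounds; [exact Ht | rewrite Rabs_pos_eq; lra]).
  apply Rle_trans with (parabola tau r ^ S (S n)).
  - apply bernoulli_le. unfold parabola in Hb. split; [apply pow2_ge_0 | lra].
  - apply pow_incr; split; [apply Hb |].
    apply parabola_le; [exact Ht |]. rewrite (Rabs_pos_eq r) by exact Hr0. exact Hx.
Qed.

(** The cutoff tends to [1] uniformly on [[- R0, R0]] as [tau] grows. Since [g] may change sign, the
    loss is estimated through the maximum of its absolute value. *)
Lemma RInt_cutoff_ge_half (n : nat) (g : R -> R) (R0 : R) :
  0 < R0 -> (forall x, continuous g x) -> (forall x, R0 < Rabs x -> g x = 0) ->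
  0 < RInt g (- R0) R0 ->
  exists tau0, R0 <= tau0 /\ forall tau, tau0 <= tau ->
    RInt g (- R0) R0 / 2 <= RInt (fun x => g x * cutoff n tau x) (- tau) tau.
Proof.
  intros HR Hc Hv Hg.
  set (I := RInt g (- R0) R0) in *.
  destruct (continuity_ab_maj (fun x => Rabs (g x)) (- R0) R0) as [xM [HM _]]; [lra | |].
  { intros x _. apply continuity_pt_filterlim.
    apply (continuous_comp g Rabs); [apply Hc | apply continuous_Rabs]. }
  set (M := Rabs (g xM)) in *.
  assert (HM0 : 0 <= M) by apply Rabs_pos.
  set (k := INR (S (S n))).
  assert (Hk : 0 < k) by (apply lt_0_INR; lia).
  (* Chosen so that [Q <= tau ^ 2] limits the total loss [2 * R0 * m] to [I / 2]; this follows from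
     [tau >= 1] and [tau >= Q]. *)
  set (Q := 4 * R0 * M * k * R0 ^ 2 / I).
  assert (HR2 : 0 <= R0 * M) by (apply Rmult_le_pos; lra).
  assert (HR3 : 0 <= R0 * M * k * R0 ^ 2).
  { apply Rmult_le_pos; [apply Rmult_le_pos; lra | apply pow2_ge_0]. }
  assert (HQ : 0 <= Q).
  { unfold Q, Rdiv. apply Rmult_le_pos; [lra | left; apply Rinv_0_lt_compat, Hg]. }
  exists (1 + R0 + Q); split; [lra |].
  intros tau Htau.
  assert (Ht : 0 < tau) by lra.
  assert (Ht' : tau <> 0) by lra.
  assert (Kc : forall x, continuous (fun x => g x * cutoff n tau x) x).
  { intros x. apply @continuous_mult; [apply Hc | apply continuous_cutoff, Ht']. }
  rewrite (is_RInt_unique _ _ _ _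
    (is_RInt_vanish_outside (fun x => g x * cutoff n tau x) R0 (- tau) tau Kc
       ltac:(intros x Hx; cbv beta; rewrite Hv by exact Hx; ring)
       ltac:(lra) ltac:(lra) ltac:(lra))).
  set (m := M * (k * (R0 / tau) ^ 2)).
  assert (Hm : 2 * R0 * m <= I / 2).
  { assert (E : 2 * R0 * m = Q * I / 2 / tau ^ 2) by (unfold m, Q; field; lra).
    rewrite E.
    assert (Ht2 : Q <= tau ^ 2) by nra.
    apply Rmult_le_reg_r with (tau ^ 2); [apply pow_lt, Ht |].
    unfold Rdiv at 1. rewrite Rmult_assoc, Rinv_l by (apply pow_nonzero, Ht').
    nra. }
  apply Rle_trans with (RInt (fun x => minus (g x) m) (- R0) R0).
  - rewrite (RInt_minus (V := R_CompleteNormedModule) g (fun _ => m)).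
    + rewrite RInt_const. fold I. unfold minus, plus, opp, scal; simpl. unfold mult; simpl. lra.
    + apply @ex_RInt_continuous; intros; apply Hc.
    + apply ex_RInt_const.
  - apply RInt_le; [lra | | |].
    + apply @ex_RInt_continuous; intros.
      apply @continuous_minus; [apply Hc | apply continuous_const].
    + apply @ex_RInt_continuous; intros; apply Kc.
    + intros x Hx.
      assert (Hgx : Rabs (g x) <= M) by (apply HM; lra).
      assert (Hax : Rabs x <= R0) by (apply Rabs_le; lra).
      assert (C0 := cutoff_ge n tau x R0 Ht Hax ltac:(lra)). fold k in C0.
      destruct (cutoff_bounds n tau x Ht ltac:(lra)) as [_ C1].
      apply Rabs_le_between in Hgx.
      set (chi := cutoff n tau x) in *.
      set (e := k * (R0 / tau) ^ 2) in *.
      change (g x + - m <= g x * chi). unfold m.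
      nra.
Qed.

(** The nonlinear term is only used to absorb the linear one: [J(0) >= eps I / 2] and [J(tau) = 0]
    already contradict a large [tau]. The bound is proved for any existence time [T], with [C] fixed
    before [eps]. *)
Lemma lifespan_bound_positive_mean (p R0 : R) (f g : R -> R) :
  1 < p -> 0 < R0 ->
  (forall x, continuous g x) -> (forall x, R0 < Rabs x -> g x = 0) ->
  0 < RInt g (- R0) R0 ->
  exists C, 0 < C /\ forall eps, 0 < eps <= 1 -> forall T u,
    classical_solution p (fun x => eps * f x) (fun x => eps * g x) T u ->
    Rbar_le T (C * Rpower eps (- ((p - 1) / 2))).
Proof.
  intros Hp HR Hc Hv Hg.
  set (q := / (p - 1)).
  assert (Hq : 0 < q) by (apply Rinv_0_lt_compat; lra).
  destruct (exists_pos_nat_ge (2 * q)) as [n [Hn Hqn]].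
  destruct (RInt_cutoff_ge_half n g R0 HR Hc Hv Hg) as [tau0 [Ht0 Hhalf]].
  set (I := RInt g (- R0) R0) in *.
  set (K := cutoff_const n). assert (HK : 0 < K) by apply cutoff_const_pos.
  (* The Young error carries a factor [4], and division by [I / 2] doubles it. *)
  set (D := 8 * K * Rpower (4 * K) q / I).
  assert (HD : 0 < D).
  { apply Rdiv_lt_0_compat; [| exact Hg].
    apply Rmult_lt_0_compat; [lra | apply exp_pos]. }
  exists (tau0 + Rpower D (/ (2 * q))); split.
  { assert (H := exp_pos (/ (2 * q) * ln D)). unfold Rpower. lra. }
  intros eps Heps T u [HT0 (ux & ut & uxx & uxt & utx & utt & Cu & Cux & Cut & Heq & Hu0 & Hut0)].
  replace (- ((p - 1) / 2)) with (- (1 / (2 * q))) by (unfold q; field; lra).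
  apply Rbar_le_of_decay; try lra.
  intros tau Htau HT.
  assert (Ht : 0 < tau) by lra.
  assert (H := weighted_momentum_increment p q tau 0 tau 0 0 n T u ux ut uxx uxt utx utt
                 (fun _ => 0) Hp eq_refl Hqn Hn Cu Cux Cut Heq (Rle_refl 0) Ht (Rle_refl tau)
                 HT (Rle_refl 0)).
  rewrite weighted_momentum_tau, weighted_momentum_0 in H by lra.
  rewrite (RInt_ext _ (fun x => scal eps (g x * cutoff n tau x))) in H
    by (intros x _; rewrite Hut0; unfold scal; simpl; unfold mult; simpl; ring).
  rewrite (RInt_scal (V := R_CompleteNormedModule) (fun x => g x * cutoff n tau x)) in H.
  2:{ apply @ex_RInt_continuous; intros x _.
      apply @continuous_mult; [apply Hc | apply continuous_cutoff; lra]. }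
  fold K in H.
  assert (H' := young_error_scaling K tau q HK Ht).
  assert (Hh := Hhalf tau Htau).
  set (J := RInt (fun x => g x * cutoff n tau x) (- tau) tau) in *.
  set (E := K / tau ^ 2 * Rpower (4 * (K / tau ^ 2)) q) in *.
  assert (H1 : (tau - 0) * (0 * 0 - 4 * tau * E) <= 0 - scal eps J).
  { apply H.
    - intros; lra.
    - intros x t Ht' Hx. rewrite Rplus_0_l in Hx.
      assert (Hx0 : Rabs x <= tau) by (apply Rabs_le; lra).
      assert (Ht0' : Rabs t <= tau) by (apply Rabs_le; lra).
      destruct (cutoff_bounds n tau x Ht Hx0) as [C0 _].
      destruct (cutoff_bounds n tau t Ht Ht0') as [C0' _].
      assert (HP := Rmult_le_pos _ _ (abs_power_ge_0 p (u x t)) (Rmult_le_pos _ _ C0 C0')).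
      lra. }
  unfold scal in H1; simpl in H1; unfold mult in H1; simpl in H1.
  rewrite Rpower_1 by lra.
  assert (H2 : eps * (I / 2) <= eps * J) by (apply Rmult_le_compat_l; lra).
  apply Rmult_le_reg_r with (I / 2); [lra |].
  replace (D * Rpower tau (- (2 * q)) * (I / 2))
    with (4 * K * Rpower (4 * K) q * Rpower tau (- (2 * q))) by (unfold D; field; lra).
  rewrite <- H'. simpl. lra.
Qed.

Lemma Rpower_le_abs_power (p y v : R) :
  0 < p -> 0 < y -> y <= v -> Rpower y p <= abs_power p v.
Proof.
  intros Hp Hy Hv. unfold abs_power. destruct (Req_EM_T v 0) as [E | _]; [lra |].
  rewrite Rabs_pos_eq by lra. apply Rle_Rpower_l; lra.
Qed.

(** Here [7/16] is [1 - (3/4)^2]. *)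
Lemma cutoff_ge_inner (n : nat) (tau x : R) :
  0 < tau -> Rabs x <= 3 / 4 * tau -> (7 / 16) ^ S (S n) <= cutoff n tau x.
Proof.
  intros Ht Hx. apply pow_incr; split; [lra |].
  replace (7 / 16) with (parabola tau (3 / 4 * tau)).
  - apply parabola_le; [exact Ht |]. rewrite (Rabs_pos_eq (3 / 4 * tau)); lra.
  - unfold parabola. field. lra.
Qed.

(** Now [J(0) = 0], so the lower bound must come from the nonlinear term. The right-moving half of
    the initial bump keeps [u] above [eps * (m / 2)] on a window of width [2 d] that travels with
    speed [1]. *)
Lemma lifespan_bound_zero_velocity (p R0 : R) (f g : R -> R) :
  1 < p -> 0 < R0 ->
  (forall x, continuous f x) -> (forall x, R0 < Rabs x -> f x = 0) ->
  (forall x, 0 <= f x) -> (exists x, f x <> 0) -> (forall x, g x = 0) ->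
  exists C, 0 < C /\ forall eps, 0 < eps <= 1 -> forall T u,
    classical_solution p (fun x => eps * f x) (fun x => eps * g x) T u ->
    Rbar_le T (C * Rpower eps (- (p * (p - 1) / (p + 1)))).
Proof.
  intros Hp HR Hc Hv Hf0 [x0 Hx0] Hg.
  assert (Hfx0 : 0 < f x0) by (specialize (Hf0 x0); lra).
  assert (HxR : Rabs x0 <= R0).
  { destruct (Rle_lt_dec (Rabs x0) R0) as [H | H]; [exact H |].
    exfalso; apply Hx0, Hv, H. }
  apply Rabs_le_between in HxR.
  set (m := f x0 / 2).
  assert (Hm : 0 < m) by (unfold m; lra).
  destruct (proj1 (filterlim_locally _ _) (Hc x0) (mkposreal m Hm)) as [d' Hd'].
  set (d := d' / 2).
  assert (Hd : 0 < d) by (unfold d; assert (H := cond_pos d'); lra).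
  assert (Hfd : forall x, x0 - d <= x <= x0 + d -> m <= f x).
  { intros x Hx.
    assert (Hb : Rabs (f x - f x0) < m).
    { apply Hd'. change (Rabs (x - x0) < d'). apply Rabs_def1; unfold d in *; lra. }
    apply Rabs_def2 in Hb. unfold m in *. lra. }
  set (q := / (p - 1)).
  assert (Hq : 0 < q) by (apply Rinv_0_lt_compat; lra).
  destruct (exists_pos_nat_ge (2 * q)) as [n [Hn Hqn]].
  set (K := cutoff_const n). assert (HK : 0 < K) by apply cutoff_const_pos.
  set (c1 := (7 / 16) ^ S (S n)).
  assert (Hc1 : 0 < c1) by (apply pow_lt; lra).
  assert (Hmp : 0 < Rpower (m / 2) p) by apply exp_pos.
  (* Per unit of [tau] and of [eps^p]: duration [tau / 2], width [2 d], the surviving half of the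
     nonlinear term, and a factor [c1] for each cutoff. *)
  set (A := d * / 2 * (Rpower (m / 2) p * (c1 * c1))).
  assert (HA : 0 < A).
  { apply (Rmult_lt_0_compat (d * / 2)); [lra |].
    apply Rmult_lt_0_compat; [exact Hmp | apply Rmult_lt_0_compat; exact Hc1]. }
  set (D := 4 * K * Rpower (4 * K) q / A).
  assert (HD : 0 < D).
  { apply Rdiv_lt_0_compat; [| exact HA].
    apply Rmult_lt_0_compat; [lra | apply exp_pos]. }
  (* Equal to [(p + 1) / (p - 1)]; the extra [1] comes from the gain growing linearly in [tau]. *)
  set (a := 1 + 2 * q).
  (* For [tau >= 4 * (R0 + d)] and [t <= tau / 2] the travelling window stays in
     [|x| <= 3/4 tau]. *)
  exists (4 * (R0 + d) + Rpower D (/ a)); split.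
  { assert (H := exp_pos (/ a * ln D)). unfold Rpower. lra. }
  intros eps Heps T u [HT0 (ux & ut & uxx & uxt & utx & utt & Cu & Cux & Cut & Heq & Hu0 & Hut0)].
  replace (p * (p - 1) / (p + 1)) with (p / a) by (unfold a, q; field; split; lra).
  apply Rbar_le_of_decay; try lra; [unfold a; lra |].
  intros tau Htau HT.
  assert (Ht : 0 < tau) by lra.
  (* On this window [x - t] stays within [d] of [x0], where [f >= m]; the other d'Alembert term is
     nonnegative and is dropped. *)
  assert (Hlow : forall x t, 0 <= t <= tau / 2 -> x0 - d + t <= x <= x0 - d + t + 2 * d ->
            / 2 * (Rpower eps p * Rpower (m / 2) p * (c1 * c1)) <=
            / 2 * (abs_power p (u x t) * (cutoff n tau x * cutoff n tau t))).
  { intros x t Htt Hx.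
    assert (Hs : slab T (x, t)).
    { split; simpl; [lra |].
      apply (Rbar_le_lt_trans t tau T); [simpl; lra | exact HT]. }
    assert (Hux : eps * (m / 2) <= u x t).
    { assert (H := dalembert_lower_bound T u ux ut uxx uxt utx utt x t HT0 Cu Cux Cut).
      rewrite !Hu0 in H.
      apply Rle_trans with ((eps * f (x - t) + eps * f (x + t)) / 2).
      - assert (H1 := Hfd (x - t) ltac:(lra)). assert (H2 := Hf0 (x + t)).
        assert (H3 : eps * m <= eps * f (x - t)) by (apply Rmult_le_compat_l; lra).
        assert (H4 : 0 <= eps * f (x + t)) by (apply Rmult_le_pos; lra).
        lra.
      - apply H; [| | exact Hs].
        + intros y s Hys. rewrite (Heq y s Hys). apply abs_power_ge_0.
        + intros y. rewrite Hut0, Hg. ring. }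
    assert (Hem : 0 < eps * (m / 2)) by (apply Rmult_lt_0_compat; lra).
    assert (HP := Rpower_le_abs_power p _ _ ltac:(lra) Hem Hux).
    rewrite <- Rpower_mult_distr in HP by lra.
    assert (C1 : c1 <= cutoff n tau x) by (apply cutoff_ge_inner; [| apply Rabs_le]; lra).
    assert (C2 : c1 <= cutoff n tau t) by (apply cutoff_ge_inner; [| apply Rabs_le]; lra).
    apply Rmult_le_compat_l; [lra |].
    apply Rmult_le_compat; try exact HP.
    - left; apply Rmult_lt_0_compat; apply exp_pos.
    - left; apply Rmult_lt_0_compat; exact Hc1.
    - apply Rmult_le_compat; lra. }
  assert (H1 := weighted_momentum_increment p q tau 0 (tau / 2) (2 * d) _ n T
                 u ux ut uxx uxt utx utt (fun t => x0 - d + t)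
                 Hp eq_refl Hqn Hn Cu Cux Cut Heq (Rle_refl 0) ltac:(lra) ltac:(lra)
                 HT ltac:(lra) ltac:(intros t Htt; split; lra)
                 (fun x t Htt Hx => Hlow x t Htt Hx)).
  (* On the second half the time cutoff degenerates, so no gain is claimed there. *)
  assert (H2 : (tau - tau / 2) * (0 * 0 - 4 * tau *
       (cutoff_const n / tau ^ 2 * Rpower (4 * (cutoff_const n / tau ^ 2)) q)) <=
     weighted_momentum n tau u ut tau - weighted_momentum n tau u ut (tau / 2)).
  { apply (weighted_momentum_increment p q tau (tau / 2) tau 0 0 n T
             u ux ut uxx uxt utx utt (fun _ => 0)); try assumption; try lra; try reflexivity.
    - intros; lra.
    - intros x t Htt Hx.
      assert (Hx' : Rabs x <= tau) by (apply Rabs_le; lra).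
      assert (Ht' : Rabs t <= tau) by (apply Rabs_le; lra).
      destruct (cutoff_bounds n tau x Ht Hx') as [C0 _].
      destruct (cutoff_bounds n tau t Ht Ht') as [C0' _].
      assert (HP := Rmult_le_pos _ _ (abs_power_ge_0 p (u x t)) (Rmult_le_pos _ _ C0 C0')).
      lra. }
  rewrite weighted_momentum_tau in H2 by lra.
  rewrite weighted_momentum_0 in H1 by lra.
  rewrite (RInt_ext _ (fun _ => 0)) in H1
    by (intros x _; rewrite Hut0, Hg; simpl; ring).
  rewrite RInt_const in H1. unfold scal in H1; simpl in H1; unfold mult in H1; simpl in H1.
  fold K in H1, H2.
  assert (H' := young_error_scaling K tau q HK Ht).
  simpl in H', H2.
  set (E := K / (tau * (tau * 1)) * Rpower (4 * (K / (tau * (tau * 1)))) q) in *.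
  (* Adding the two increments eliminates the momentum at [tau / 2]. *)
  assert (H3 : tau * (A * Rpower eps p) <= 4 * (tau * (tau * 1)) * E) by (unfold A; lra).
  rewrite H' in H3.
  replace (- a) with (- (2 * q) + - (1)) by (unfold a; ring).
  rewrite Rpower_plus, (Rpower_Ropp tau 1), Rpower_1 by exact Ht.
  apply Rmult_le_reg_l with (tau * A); [apply Rmult_lt_0_compat; assumption |].
  replace (tau * A * (D * (Rpower tau (- (2 * q)) * / tau)))
    with (4 * K * Rpower (4 * K) q * Rpower tau (- (2 * q))) by (unfold D; field; lra).
  lra.
Qed.

Theorem theorem5p1 :
  forall (p R0 : R) (f g : R -> R),
    1 < p -> 0 < R0 ->
    class_C 2 f -> class_C 1 g ->
    included (support2 f g) (fun x => Rabs x <= R0) ->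
    exists eps3 C : R, 0 < eps3 /\ 0 < C /\
      forall eps : R, 0 < eps <= eps3 ->
      forall u : R -> R -> R,
        classical_solution p (fun x => eps * f x) (fun x => eps * g x)
          (lifespan p f g eps) u ->
        (0 < RInt_gen g (Rbar_locally m_infty) (Rbar_locally p_infty) ->
          Rbar_le (lifespan p f g eps) (C * Rpower eps (- ((p - 1) / 2)))) /\
        ((forall x : R, 0 <= f x) -> (exists x : R, f x <> 0) ->
         (forall x : R, g x = 0) ->
          Rbar_le (lifespan p f g eps)
            (C * Rpower eps (- (p * (p - 1) / (p + 1))))).
Proof.
  intros p R0 f g Hp HR Hf Hg Hsupp.
  assert (Hcf : forall x, continuous f x).
  { intros x. apply @ex_derive_continuous. exact (proj1 Hf 1%nat x ltac:(lia)). }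
  assert (Hcg : forall x, continuous g x).
  { intros x. apply @ex_derive_continuous. exact (proj1 Hg 1%nat x ltac:(lia)). }
  assert (Hvf : forall x, R0 < Rabs x -> f x = 0).
  { intros x Hx. apply (support2_vanish f g R0 x Hsupp Hx). }
  assert (Hvg : forall x, R0 < Rabs x -> g x = 0).
  { intros x Hx. apply (support2_vanish f g R0 x Hsupp Hx). }
  (* The constant must be chosen before the sign of the integral is assumed, hence the case
     distinction; in the false case any positive constant serves. *)
  assert (H1 : exists C, 0 < C /\ (0 < RInt g (- R0) R0 ->
    forall eps, 0 < eps <= 1 -> forall T u,
    classical_solution p (fun x => eps * f x) (fun x => eps * g x) T u ->
    Rbar_le T (C * Rpower eps (- ((p - 1) / 2))))).
  { destruct (classic (0 < RInt g (- R0) R0)) as [H | H].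
    - destruct (lifespan_bound_positive_mean p R0 f g Hp HR Hcg Hvg H) as [C [HC HB]].
      exists C; split; [exact HC | intros _; exact HB].
    - exists 1; split; [lra | intros H'; contradiction]. }
  assert (H2 : exists C, 0 < C /\
    ((forall x, 0 <= f x) -> (exists x, f x <> 0) -> (forall x, g x = 0) ->
    forall eps, 0 < eps <= 1 -> forall T u,
    classical_solution p (fun x => eps * f x) (fun x => eps * g x) T u ->
    Rbar_le T (C * Rpower eps (- (p * (p - 1) / (p + 1)))))).
  { destruct (classic ((forall x, 0 <= f x) /\ (exists x, f x <> 0) /\ (forall x, g x = 0)))
      as [(Ha & Hb & Hc) | H].
    - destruct (lifespan_bound_zero_velocity p R0 f g Hp HR Hcf Hvf Ha Hb Hc) as [C [HC HB]].
      exists C; split; [exact HC | intros _ _ _; exact HB].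
    - exists 1; split; [lra | intros Ha Hb Hc; exfalso; tauto]. }
  destruct H1 as [C1 [HC1 H1]]. destruct H2 as [C2 [HC2 H2]].
  (* The sum dominates both constants, and the powers of [eps] that it multiplies are positive. *)
  exists 1, (C1 + C2); split; [lra | split; [lra |]].
  intros eps Heps u Hu.
  rewrite (RInt_gen_vanish_outside g R0 HR Hcg Hvg).
  split.
  - intros Hpos. apply Rbar_le_trans with (1 := H1 Hpos eps Heps _ u Hu).
    simpl. apply Rmult_le_compat_r; [left; apply exp_pos | lra].
  - intros Ha Hb Hc. apply Rbar_le_trans with (1 := H2 Ha Hb Hc eps Heps _ u Hu).
    simpl. apply Rmult_le_compat_r; [left; apply exp_pos | lra].
Qed.
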